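(* Let $A=\oplus_{h\in H}A_h$ be a graded algebra with enough idempotents, let $(e_i)_{i\in I}$ be a distinguished family of primitive idempotents and, for each finite subset $F\subseteq I$, put $e_F=\sum_{i\in F}e_i$. For a graded vector subspace $J=\oplus_{i,j\in I}e_iJe_j$ of $A$, the following assertions are equivalent: 1. $J$ is the intersection of all maximal graded left ideals of $A$. 2. $J$ is the intersection of all maximal graded right ideals of $A$. 3. For all $i,j\in I$ and $h\in H$, a homogeneous element $x\in e_iA_he_j$ is in $J$ if, and only if, the element $e_j-yx$ is invertible in $e_jA_0e_j$ for each $y\in e_jA_{-h}e_i$. 4. For all $i,j\in I$ and $h\in H$, a homogeneous element $x\in e_iA_he_j$ is in $J$ if, and only if, the element $e_i-xy$ is invertible in $e_iA_0e_i$ for each $y\in e_jA_{-h}e_i$. 5. $J=\bigcup_{F\subseteq I,\ F\text{ finite}}J^{gr}(e_FAe_F)$.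
   Context: $K$ is a fixed field and $H$ a fixed abelian group, written additively. Algebras are associative $K$-algebras, not necessarily unital. A *graded algebra with enough idempotents* is an $H$-graded algebra $A=\oplus_{h\in H}A_h$ having a family $(e_i)_{i\in I}$ of nonzero orthogonal idempotents, homogeneous of degree $0$, with $\oplus_{i\in I}e_iA=A=\oplus_{i\in I}Ae_i$; such a family is called a *distinguished family*. For a unital graded algebra $B=\oplus_{h\in H}B_h$, $J^{gr}(B)$ denotes the intersection of all maximal graded left ideals of $B$, which coincides with the intersection of all its maximal graded right ideals. Each $e_FAe_F$ is a unital graded algebra with unit $e_F$. *)

(* Defs.v *)
(* Subspaces and ideals may be infinite-dimensional and undecidable, hence the
   use of Prop-valued sets instead of boolean predicates. *)
From HB Require Import structures.
From mathcomp Require Import all_boot all_order all_algebra.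
From mathcomp Require Import finmap.
From mathcomp Require Import boolp classical_sets.

Set Implicit Arguments.
Unset Strict Implicit.
Unset Printing Implicit Defensive.

Import GRing.Theory.
Local Open Scope classical_set_scope.
Local Open Scope ring_scope.

(* The rings of ssralg all have a unit, hence this structure of associative,
   not necessarily unital, K-algebras. *)
HB.mixin Record Lmodule_isNUAlgebra (K : fieldType) A of GRing.Lmodule K A := {
  numul : A -> A -> A;
  numulA : associative numul;
  numulDl : left_distributive numul +%R;
  numulDr : right_distributive numul +%R;
  numulZl : forall (a : K) (x y : A), numul (a *: x) y = a *: numul x y;
  numulZr : forall (a : K) (x y : A), numul x (a *: y) = a *: numul x y
}.

#[short(type="nuAlgType")]
HB.structure Definition NUAlgebra (K : fieldType) :=
  {A of GRing.Lmodule K A & Lmodule_isNUAlgebra K A}.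

Notation "x ** y" := (numul x y)
  (at level 40, left associativity) : ring_scope.

Definition is_subspace (K : fieldType) (V : lmodType K) (U : set V) : Prop :=
  submod_closed (mem U).

(* U is the internal direct sum of the (possibly infinite) family W. *)
Definition is_direct_sum (V : zmodType) (T : choiceType)
    (W : T -> set V) (U : set V) : Prop :=
  U = [set v | exists (F : {fset T}) (w : T -> V),
         (forall t, t \in F -> W t (w t)) /\ v = \sum_(t <- F) w t]
  /\ (forall (F : {fset T}) (w : T -> V),
        (forall t, t \in F -> W t (w t)) ->
        \sum_(t <- F) w t = 0 -> forall t, t \in F -> w t = 0).

Record is_grading (K : fieldType) (H : zmodType) (A : nuAlgType K)
    (gr : H -> set A) : Prop := IsGrading {
  grading_subspace : forall h, is_subspace (gr h);
  grading_sum : is_direct_sum gr setT;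
  grading_mul : forall g h x y, gr g x -> gr h y -> gr (g + h) (x ** y)
}.

Definition graded_subspace (K : fieldType) (H : zmodType) (A : nuAlgType K)
    (gr : H -> set A) (U : set A) : Prop :=
  is_subspace U /\ is_direct_sum (fun h => U `&` gr h) U.

(* The set e S f = {e s f | s in S}. *)
Definition corner (K : fieldType) (A : nuAlgType K)
    (e : A) (S : set A) (f : A) : set A := [set e ** s ** f | s in S].

Record distinguished_family (K : fieldType) (H : zmodType) (A : nuAlgType K)
    (gr : H -> set A) (I : choiceType) (e : I -> A) : Prop :=
  DistinguishedFamily {
    dist_neq0 : forall i, e i <> 0;
    dist_idem : forall i, e i ** e i = e i;
    dist_orth : forall i j, i <> j -> e i ** e j = 0;
    dist_deg0 : forall i, gr 0 (e i);
    dist_suml : is_direct_sum (fun i => [set e i ** a | a in setT]) setT;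
    dist_sumr : is_direct_sum (fun i => [set a ** e i | a in setT]) setT
  }.

Definition primitive_idempotent (K : fieldType) (A : nuAlgType K)
    (e : A) : Prop :=
  [/\ e <> 0, e ** e = e &
      forall f g : A, f ** f = f -> g ** g = g -> f ** g = 0 -> g ** f = 0 ->
        e = f + g -> f = 0 \/ g = 0].

(* u is invertible in the algebra carried by the subset S of A, whose unit
   is e. *)
Definition invertible_in (K : fieldType) (A : nuAlgType K)
    (S : set A) (e u : A) : Prop :=
  S u /\ exists z, [/\ S z, u ** z = e & z ** u = e].

(* In what follows, B is (the carrier of) a graded subalgebra of A, with the
   grading induced by gr. *)
Section GradedIdeals.
Variables (K : fieldType) (H : zmodType) (A : nuAlgType K).
Variables (gr : H -> set A) (B : set A).

Definition graded_left_ideal (L : set A) : Prop :=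
  [/\ graded_subspace gr L, L `<=` B &
      forall b x, B b -> L x -> L (b ** x)].

Definition graded_right_ideal (L : set A) : Prop :=
  [/\ graded_subspace gr L, L `<=` B &
      forall b x, B b -> L x -> L (x ** b)].

Definition maximal_graded_left_ideal (M : set A) : Prop :=
  [/\ graded_left_ideal M, M <> B &
      forall L, graded_left_ideal L -> M `<=` L -> L = M \/ L = B].

Definition maximal_graded_right_ideal (M : set A) : Prop :=
  [/\ graded_right_ideal M, M <> B &
      forall L, graded_right_ideal L -> M `<=` L -> L = M \/ L = B].

(* Intersecting with B only matters when B has no maximal graded left ideal
   (for instance B = 0): the empty intersection is then B. *)
Definition gr_jacobson : set A :=
  B `&` \bigcap_(M in maximal_graded_left_ideal) M.

End GradedIdeals.

Definition idem_sum (K : fieldType) (A : nuAlgType K) (I : choiceType)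
    (e : I -> A) (F : {fset I}) : A := \sum_(i <- F) e i.

(* Main.v *)
Require Import Defs.
From HB Require Import structures.
From mathcomp Require Import all_boot all_order all_algebra.
From mathcomp Require Import finmap.
From mathcomp Require Import boolp classical_sets.

Set Implicit Arguments.
Unset Strict Implicit.
Unset Printing Implicit Defensive.

Import GRing.Theory.
Local Open Scope classical_set_scope.
Local Open Scope ring_scope.

(** Why the assertions are equivalent.

   Call a homogeneous x in e_i A_h e_j left quasi-regular if e_j - y x is
   invertible in e_j A_0 e_j for all y in e_j A_(-h) e_i, and let Q be the set
   of those a in A for which every e_i a_h e_j is left quasi-regular.  The
   usual description of the Jacobson radical, carried out one Peirce component
   at a time, says that Q is the intersection of the maximal graded left
   ideals, both of A and, after intersecting with the corner, of every
   e_F A e_F.  The single statement behind all these cases is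
   gr_jacobson_peirce, about the corner B spanned by the e_i A e_j with i, j in
   an arbitrary subset S of I; S = I gives A, a finite S gives e_F A e_F.

   - A left quasi-regular x lies in every maximal M
     (mem_maximal_of_quasi_regular).  Otherwise M + B x = B contains e_j; the
     Peirce-homogeneous part of an equation e_j = m + b x puts some e_j - y x
     in M, hence its left multiple e_j, hence x = x e_j.

   - If b lies in every maximal M, then x = e_i b_h e_j is left quasi-regular
     (quasi_regular_of_mem_jacobson).  If u = e_j - y x had no left inverse, the
     graded left ideal {c | c e_j in A u} would be proper.  Zorn's lemma would
     put it inside a maximal M missing e_j, although both e_j - y b_h and y b_h
     lie in M.  Testing {c | c e_j in A u} rather than A u makes it possible
     to use b_h instead of b_h e_j, so it need not be known in advance that the
     intersection of the M is stable under right multiplication.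

   Since J is graded and is the sum of its Peirce components, it is determined
   by its homogeneous elements in the e_i A e_j; so J = Q is the same as the
   third assertion (eq_quasi_regular_setP), and both the first and the fifth
   say J = Q.  The second and fourth assertions are the first and third for
   the opposite algebra.  The two halves are tied together by the symmetry
   between e_j - y x and e_i - x y (left_right_quasi_regular). *)

(** * Subspaces and products *)

Section Subspaces.
Variables (K : fieldType) (V : lmodType K).
Implicit Types (U : set V) (u v : V).

Lemma subspaceP U :
  is_subspace U <-> U 0 /\ forall (a : K) u v, U u -> U v -> U (a *: u + v).
Proof.
split=> -[U0 UL]; split=> [|a u v Uu Uv]; rewrite ?in_setE //.
- by move: U0; rewrite in_setE.
- by have := UL a u v; rewrite !in_setE; apply.
- by apply: UL; [move: Uu | move: Uv]; rewrite in_setE.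
Qed.

Variables (U : set V) (Usub : is_subspace U).

Lemma subspace0 : U 0.
Proof. by case/subspaceP: Usub. Qed.

Lemma subspaceD u v : U u -> U v -> U (u + v).
Proof. by case/subspaceP: Usub => _ UL Uu Uv; rewrite -[u]scale1r; exact: UL. Qed.

Lemma subspaceZ (a : K) u : U u -> U (a *: u).
Proof.
case/subspaceP: Usub => U0 UL Uu; rewrite -[_ *: _]addr0; exact: UL.
Qed.

Lemma subspaceN u : U u -> U (- u).
Proof. by rewrite -scaleN1r; exact: subspaceZ. Qed.

Lemma subspaceB u v : U u -> U v -> U (u - v).
Proof. by move=> Uu Uv; apply/subspaceD/subspaceN. Qed.

Lemma subspace_sum (T : eqType) (s : seq T) (F : T -> V) :
  (forall t, t \in s -> U (F t)) -> U (\sum_(t <- s) F t).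
Proof.
move=> UF; rewrite big_seq; apply: (big_ind U) => //; first exact: subspace0.
exact: subspaceD.
Qed.

End Subspaces.

Section Multiplication.
Variables (K : fieldType) (A : nuAlgType K).
Implicit Types x y z : A.

Lemma numul0l x : 0 ** x = 0.
Proof. by rewrite -(scale0r (0 : A)) numulZl !scale0r. Qed.

Lemma numul0r x : x ** 0 = 0.
Proof. by rewrite -(scale0r (0 : A)) numulZr !scale0r. Qed.

Lemma numulNl x y : (- x) ** y = - (x ** y).
Proof. by rewrite -!scaleN1r numulZl. Qed.

Lemma numulBl x y z : (x - y) ** z = x ** z - y ** z.
Proof. by rewrite numulDl numulNl. Qed.

Lemma numulBr x y z : x ** (y - z) = x ** y - x ** z.
Proof. by rewrite numulDr -!scaleN1r numulZr. Qed.

Lemma numul_suml (T : Type) (s : seq T) (F : T -> A) x :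
  (\sum_(t <- s) F t) ** x = \sum_(t <- s) F t ** x.
Proof.
by apply: (big_morph (fun y => y ** x)) => [y z|]; rewrite ?numulDl ?numul0l.
Qed.

Lemma numul_sumr (T : Type) (s : seq T) (F : T -> A) x :
  x ** (\sum_(t <- s) F t) = \sum_(t <- s) x ** F t.
Proof.
by apply: (big_morph (fun y => x ** y)) => [y z|]; rewrite ?numulDr ?numul0r.
Qed.

End Multiplication.

(** * The opposite algebra *)

Section Opposite.
Variables (K : fieldType) (A : nuAlgType K).

Definition opposite : Type := A.

HB.instance Definition _ := GRing.Lmodule.on opposite.

Definition opposite_mul (x y : opposite) : opposite := (y : A) ** (x : A).

Fact opposite_mulA : associative opposite_mul.
Proof. by move=> x y z; rewrite /opposite_mul numulA. Qed.

Fact opposite_mulDl : left_distributive opposite_mul +%R.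
Proof. by move=> x y z; rewrite /opposite_mul numulDr. Qed.

Fact opposite_mulDr : right_distributive opposite_mul +%R.
Proof. by move=> x y z; rewrite /opposite_mul numulDl. Qed.

Fact opposite_mulZl (a : K) (x y : opposite) :
  opposite_mul (a *: x) y = a *: opposite_mul x y.
Proof. by rewrite /opposite_mul numulZr. Qed.

Fact opposite_mulZr (a : K) (x y : opposite) :
  opposite_mul x (a *: y) = a *: opposite_mul x y.
Proof. by rewrite /opposite_mul numulZl. Qed.

HB.instance Definition _ := Lmodule_isNUAlgebra.Build K opposite
  opposite_mulA opposite_mulDl opposite_mulDr opposite_mulZl opposite_mulZr.

End Opposite.

(** * Homogeneous components *)

Section Components.
Variables (K : fieldType) (H : zmodType) (A : nuAlgType K).
Variables (gr : H -> set A) (grA : is_grading gr).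
Implicit Types (a b : A) (g h : H).

Let grS h : is_subspace (gr h) := grading_subspace grA h.

(** Extending the finite decomposition by zero gives a function on all of H,
   so that components can be compared without tracking their supports. *)
Lemma homogeneous_decomposition a : exists w : H -> A,
  (forall h, gr h (w h)) /\ exists F : {fset H},
  (forall h, h \notin F -> w h = 0) /\ a = \sum_(h <- F) w h.
Proof.
have [span _] := grading_sum grA.
have : [set: A] a by [].
rewrite span => -[F [w [grw ->]]].
exists (fun h => if h \in F then w h else 0); split=> [h|].
  by case: ifP => [/grw //|_]; exact: subspace0.
exists F; split=> [h /negbTE-> //|].
by apply: eq_big_seq => h ->.
Qed.

Definition comp h a := projT1 (cid (homogeneous_decomposition a)) h.

Lemma comp_homog h a : gr h (comp h a).
Proof. by rewrite /comp; case: cid => w []. Qed.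

Lemma sum_comp a : exists F : {fset H},
  (forall h, h \notin F -> comp h a = 0) /\ a = \sum_(h <- F) comp h a.
Proof.
case: (projT2 (cid (homogeneous_decomposition a))) => _ [F [wF aE]].
by exists F.
Qed.

Lemma comp_unique (F : {fset H}) (w : H -> A) a :
    (forall h, gr h (w h)) -> (forall h, h \notin F -> w h = 0) ->
  a = \sum_(h <- F) w h -> forall h, comp h a = w h.
Proof.
move=> grw wF aE h; have [G [cG aE']] := sum_comp a.
have [_ indep] := grading_sum grA.
have [hFG|] := boolP (h \in (F `|` G)%fset); last first.
  by rewrite in_fsetU negb_or => /andP[/wF -> /cG ->].
apply/subr0_eq; apply: (indep (F `|` G)%fset (fun h => comp h a - w h)) hFG.
  by move=> t _; apply: subspaceB => //; exact: comp_homog.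
rewrite big_split sumrN /=.
rewrite -(big_fset_incl _ (fsubsetUr F G)); last by move=> ? _ /cG.
rewrite -(big_fset_incl _ (fsubsetUl F G)); last by move=> ? _ /wF.
by rewrite -aE -aE' subrr.
Qed.

Lemma comp_of_homog g a : gr g a -> forall h, comp h a = if h == g then a else 0.
Proof.
move=> ga; apply: (@comp_unique [fset g]%fset) => [h|h|].
- by case: eqP => [->|_] //; exact: subspace0.
- by rewrite in_fset1 => /negbTE->.
- by rewrite big_seq_fset1 eqxx.
Qed.

Lemma comp_id h a : gr h a -> comp h a = a.
Proof. by move/comp_of_homog->; rewrite eqxx. Qed.

Lemma compD h a b : comp h (a + b) = comp h a + comp h b.
Proof.
have [F [aF aE]] := sum_comp a; have [G [bG bE]] := sum_comp b.
move: h; apply: (@comp_unique (F `|` G)%fset) => [h|h|].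
- by apply: subspaceD => //; exact: comp_homog.
- by rewrite in_fsetU negb_or => /andP[/aF -> /bG ->]; rewrite addr0.
- rewrite big_split /=.
  rewrite -(big_fset_incl _ (fsubsetUl F G)); last by move=> ? _ /aF.
  rewrite -(big_fset_incl _ (fsubsetUr F G)); last by move=> ? _ /bG.
  by rewrite -aE -bE.
Qed.

Lemma comp0 h : comp h 0 = 0.
Proof. by rewrite (comp_of_homog (subspace0 (grS h))) eqxx. Qed.

Lemma compB h a b : comp h (a - b) = comp h a - comp h b.
Proof. by apply/(addIr (comp h b)); rewrite -compD !subrK. Qed.

(** Both one-sided multiplications by a homogeneous element are instances. *)
Lemma comp_shift g (f : A -> A) :
    {morph f : x y / x + y} -> (forall h x, gr h x -> gr (h + g) (f x)) ->
  forall h a, comp (h + g) (f a) = f (comp h a).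
Proof.
move=> fD fgr h a.
have f0 : f 0 = 0 by apply: (addIr (f 0)); rewrite -fD !add0r.
have [F [_ aE]] := sum_comp a.
have -> : f a = \sum_(t <- F) f (comp t a) by rewrite {1}aE (big_morph f fD f0).
rewrite [in RHS]aE !(big_morph _ (compD _) (comp0 _)) (big_morph f fD f0).
apply: eq_bigr => t _.
have ht := comp_homog t a; rewrite (comp_of_homog (fgr _ _ ht)) (comp_of_homog ht).
by rewrite (inj_eq (addIr g)); case: eqP.
Qed.

Lemma comp_mull g x : gr g x ->
  forall h a, comp (h + g) (x ** a) = x ** comp h a.
Proof.
move=> gx; apply: comp_shift => [u v|h u hu]; first by rewrite numulDr.
by rewrite addrC; exact: (grading_mul grA).
Qed.

Lemma comp_mulr g x : gr g x ->
  forall h a, comp (h + g) (a ** x) = comp h a ** x.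
Proof.
move=> gx; apply: comp_shift => [u v|h u hu]; first by rewrite numulDl.
exact: (grading_mul grA).
Qed.

Lemma graded_subspaceP (U : set A) :
  graded_subspace gr U <->
  is_subspace U /\ forall h a, U a -> U (comp h a).
Proof.
split=> -[Usub Ugr]; split=> //.
- move=> h a; have [span _] := Ugr; rewrite {1}span => -[F [w [Uw aE]]].
  pose w' t := if t \in F then w t else 0.
  rewrite (@comp_unique F w').
  + by rewrite /w'; case: ifP => [/Uw []//|_]; exact: subspace0.
  + by move=> t; rewrite /w'; case: ifP => [/Uw []//|_]; exact: subspace0.
  + by move=> t /negbTE tF; rewrite /w' tF.
  + by rewrite aE; apply: eq_big_seq => t tF; rewrite /w' tF.
- split.
  + rewrite eqEsubset; split=> [a Ua|_ [F [w [Uw ->]]]].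
    * have [F [_ aE]] := sum_comp a; exists F, (comp^~ a); split=> // t _.
      by split; [exact: Ugr | exact: comp_homog].
    * by apply: (subspace_sum Usub) => t /Uw[].
  + move=> F w Uw; apply: (proj2 (grading_sum grA)) => t /Uw[] //.
Qed.

End Components.

(** * Maximal graded left ideals *)

Section LeftIdeals.
Variables (K : fieldType) (H : zmodType) (A : nuAlgType K).
Variables (gr : H -> set A) (grA : is_grading gr) (B : set A).

Lemma graded_left_idealP (L : set A) :
  graded_left_ideal gr B L <->
  [/\ is_subspace L, L `<=` B, forall h a, L a -> L (comp grA h a) &
      forall b x, B b -> L x -> L (b ** x)].
Proof.
split=> [[/(graded_subspaceP grA)[Ls Lc] LB LM] | [Ls LB Lc LM]]; split=> //.
by apply/(graded_subspaceP grA).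
Qed.

(** B need not have a unit, so a proper left ideal may lie in no maximal one.
   Here f is a right unit modulo L: a left ideal that contains both L and f is
   then B, so an ideal that is maximal among those avoiding f is maximal. *)
Lemma exists_maximal_graded_left_ideal (L : set A) (f : A) :
    graded_left_ideal gr B L -> B f -> ~ L f ->
    (forall b, B b -> L (b - b ** f)) ->
  exists M, [/\ maximal_graded_left_ideal gr B M, L `<=` M & ~ M f].
Proof.
move=> idL Bf nLf Lf.
pose P X := graded_left_ideal gr B (L `|` X) /\ ~ (L `|` X) f.
(* P is imposed on L `|` X and not on X because the chains of Zorn_bigcup may be
   empty: their union must still give an ideal, here L *)
have [F FP totF|X [[idX nXf] maxX]] := @Zorn_bigcup A P.
  set N := L `|` \bigcup_(X in F) X.
  (* closure under addition needs two elements of N in a single member of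
     the chain *)
  have local u v : N u -> N v -> exists N',
      [/\ graded_left_ideal gr B N', N' `<=` N, ~ N' f, N' u & N' v].
    have inN X : F X -> L `|` X `<=` N.
      by move=> FX x [|Xx]; [left | right; exists X].
    move=> [Lu|[X FX Xu]] [Lv|[Y FY Yv]].
    - by exists L; split=> // x; left.
    - exists (L `|` Y); have [idY nYf] := FP _ FY.
      by split=> //; [exact: inN | left | right].
    - exists (L `|` X); have [idX nXf] := FP _ FX.
      by split=> //; [exact: inN | right | left].
    - have [XY|YX] := totF _ _ FX FY.
      + exists (L `|` Y); have [idY nYf] := FP _ FY.
        by split=> //; [exact: inN | right; exact: XY | right].
      + exists (L `|` X); have [idX nXf] := FP _ FX.
        by split=> //; [exact: inN | right | right; exact: YX].
  split; last by move=> Nf; have [N' []] := local f f Nf Nf.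
  apply/graded_left_idealP; split.
  - apply/subspaceP; split.
      by left; apply: subspace0; case/graded_left_idealP: idL.
    move=> a u v Nu Nv; have [N' [/graded_left_idealP[sN' _ _ _] sub _ N'u N'v]] :=
      local u v Nu Nv.
    by apply: sub; apply: subspaceD => //; exact: subspaceZ.
  - by move=> u Nu; have [N' [/graded_left_idealP[_ sB _ _] _ _ /sB]] := local u u Nu Nu.
  - move=> h u Nu; have [N' [/graded_left_idealP[_ _ cN' _] sub _ N'u _]] :=
      local u u Nu Nu.
    exact/sub/cN'.
  - move=> b u Bb Nu; have [N' [/graded_left_idealP[_ _ _ mN'] sub _ N'u _]] :=
      local u u Nu Nu.
    exact/sub/mN'.
exists (L `|` X); split=> //.
split=> //; first by move=> E; apply: nXf; rewrite E.
move=> N idN XN.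
have [Nf|nNf] := pselect (N f); [right | left].
  have [[subN _] NB mN] := idN.
  rewrite eqEsubset; split=> // b Bb; rewrite -(subrK (b ** f) b).
  by apply: subspaceD => //; [apply: XN; left; exact: Lf | exact: mN].
have LN : L `|` N = N by apply/setUidPr => x Lx; apply: XN; left.
rewrite eqEsubset; split=> // x Nx.
apply: contrapT => nXx; apply: (maxX N); last by rewrite /P LN.
split=> [y Xy|NX]; first by apply: XN; right.
by apply: nXx; right; exact: NX.
Qed.

End LeftIdeals.

(** * Peirce decomposition and corners *)

Section Peirce.
Variables (K : fieldType) (H : zmodType) (A : nuAlgType K).
Variables (gr : H -> set A) (grA : is_grading gr).
Variables (I : choiceType) (e : I -> A) (eD : distinguished_family gr e).
Implicit Types (i j : I) (h : H) (a b x y : A) (F : {fset I}).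

Local Notation comp := (comp grA).

Lemma comp_el h i a : comp h (e i ** a) = e i ** comp h a.
Proof. by rewrite -(comp_mull grA (dist_deg0 eD i)) addr0. Qed.

Lemma comp_er h i a : comp h (a ** e i) = comp h a ** e i.
Proof. by rewrite -(comp_mulr grA (dist_deg0 eD i)) addr0. Qed.

Lemma cornerP i j h x :
  corner (e i) (gr h) (e j) x <-> [/\ gr h x, e i ** x = x & x ** e j = x].
Proof.
split=> [[s hs <-]|[hx xl xr]]; last by exists x; rewrite ?xl.
split.
- rewrite -[h]addr0 -{1}[h]add0r.
  by apply: (grading_mul grA); [apply: (grading_mul grA) | ];
    rewrite //; exact: (dist_deg0 eD).
- by rewrite !numulA (dist_idem eD).
- by rewrite -numulA (dist_idem eD).
Qed.

Lemma idem_sum_mem F i : i \in F -> e i ** idem_sum e F = e i.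
Proof.
move=> iF; rewrite /idem_sum numul_sumr (big_fsetD1 i) //= (dist_idem eD).
rewrite big_seq big1 ?addr0 // => j; rewrite in_fsetD1 => /andP[/eqP ji _].
by apply: (dist_orth eD) => ij; apply: ji.
Qed.

Lemma mem_idem_sum F i : i \in F -> idem_sum e F ** e i = e i.
Proof.
move=> iF; rewrite /idem_sum numul_suml (big_fsetD1 i) //= (dist_idem eD).
rewrite big_seq big1 ?addr0 // => j; rewrite in_fsetD1 => /andP[/eqP ji _].
exact: (dist_orth eD).
Qed.

Lemma idem_sum_notin F i : i \notin F -> e i ** idem_sum e F = 0.
Proof.
move=> iF; rewrite /idem_sum numul_sumr big_seq big1 // => j jF.
by apply: (dist_orth eD) => ij; rewrite ij jF in iF.
Qed.

Lemma notin_idem_sum F i : i \notin F -> idem_sum e F ** e i = 0.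
Proof.
move=> iF; rewrite /idem_sum numul_suml big_seq big1 // => j jF.
by apply: (dist_orth eD) => ij; rewrite -ij jF in iF.
Qed.

Lemma local_unitl a : exists F, idem_sum e F ** a = a.
Proof.
have [span _] := dist_suml eD; have : [set: A] a by [].
rewrite span => -[F [w [ew ->]]]; exists F.
rewrite numul_sumr; apply: eq_big_seq => i iF; have [b _ <-] := ew i iF.
by rewrite numulA mem_idem_sum.
Qed.

Lemma local_unitr a : exists F, a ** idem_sum e F = a.
Proof.
have [span _] := dist_sumr eD; have : [set: A] a by [].
rewrite span => -[F [w [ew ->]]]; exists F.
rewrite numul_suml; apply: eq_big_seq => i iF; have [b _ <-] := ew i iF.
by rewrite -numulA idem_sum_mem.
Qed.

Lemma eq0_peirce_left a : (forall i, e i ** a = 0) -> a = 0.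
Proof.
move=> ea; have [F <-] := local_unitl a.
by rewrite /idem_sum numul_suml big1.
Qed.

Lemma eq0_peirce_right a : (forall i, a ** e i = 0) -> a = 0.
Proof.
move=> ea; have [F <-] := local_unitr a.
by rewrite /idem_sum numul_sumr big1.
Qed.

Lemma subspace_peirce (U : set A) : is_subspace U ->
  forall a, (forall i j, U (e i ** a ** e j)) -> U a.
Proof.
move=> Us a Ua; have [F aF] := local_unitl a; have [G aG] := local_unitr a.
rewrite -aF -aG /idem_sum numul_suml; apply: (subspace_sum Us) => i _.
by rewrite numulA numul_sumr; apply: (subspace_sum Us) => j _.
Qed.

Lemma subspace_homog_peirce (U : set A) : is_subspace U ->
  forall a, (forall i j h, U (e i ** comp h a ** e j)) -> U a.
Proof.
move=> Us a Ua; have [F [_ ->]] := sum_comp grA a.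
apply: (subspace_sum Us) => h _; exact: (subspace_peirce Us).
Qed.

(** The span of the e_i A e_j with i, j in S, which for infinite S need not
   be e A e for an idempotent e.  Describing it by the vanishing of the other
   Peirce components makes its closure properties immediate and covers A and
   the e_F A e_F alike. *)
Definition full_corner (S : set I) : set A :=
  [set b | forall i, ~ S i -> e i ** b = 0 /\ b ** e i = 0].

Lemma full_corner_subspace S : is_subspace (full_corner S).
Proof.
apply/subspaceP; split=> [i _|a u v Bu Bv i nSi]; first by rewrite numul0l numul0r.
have [[ul ur] [vl vr]] := (Bu i nSi, Bv i nSi).
by rewrite numulDl numulDr numulZl numulZr ul ur vl vr scaler0 addr0.
Qed.

Lemma full_corner_mul S a b :
  full_corner S a -> full_corner S b -> full_corner S (a ** b).
Proof.
move=> Ba Bb i nSi; have [[al ar] [bl br]] := (Ba i nSi, Bb i nSi).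
by rewrite numulA al numul0l -numulA br numul0r.
Qed.

Lemma full_corner_comp S h a : full_corner S a -> full_corner S (comp h a).
Proof.
move=> Ba i nSi; have [al ar] := Ba i nSi.
by rewrite -comp_el -comp_er al ar !comp0.
Qed.

Lemma full_corner_peirce S i j x : S i -> S j -> e i ** x = x -> x ** e j = x ->
  full_corner S x.
Proof.
move=> Si Sj xl xr k nSk; split.
  by rewrite -xl numulA (dist_orth eD) ?numul0l // => ki; apply: nSk; rewrite ki.
by rewrite -xr -numulA (dist_orth eD) ?numul0r // => ki; apply: nSk; rewrite -ki.
Qed.

Lemma full_cornerT : full_corner setT = setT.
Proof. by rewrite eqEsubset; split=> // a _ i []. Qed.

Lemma full_corner_fset F :
  full_corner [set` F] = corner (idem_sum e F) setT (idem_sum e F).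
Proof.
rewrite eqEsubset; split=> [b Bb|_ [b _ <-] i /negP iF]; last first.
  by rewrite !numulA idem_sum_notin // -!numulA notin_idem_sum // !numul0l !numul0r.
exists b => //.
have -> : idem_sum e F ** b = b.
  apply/eqP; rewrite eq_sym -subr_eq0; apply/eqP/eq0_peirce_left => i.
  rewrite numulBr numulA; have [iF|iF] := boolP (i \in F).
    by rewrite idem_sum_mem ?subrr.
  by rewrite idem_sum_notin // numul0l subr0; case: (Bb i) => //; exact/negP.
apply/eqP; rewrite eq_sym -subr_eq0; apply/eqP/eq0_peirce_right => i.
rewrite numulBl -numulA; have [iF|iF] := boolP (i \in F).
  by rewrite mem_idem_sum ?subrr.
by rewrite notin_idem_sum // numul0r subr0; case: (Bb i) => //; exact/negP.
Qed.

(** * Quasi-regular elements *)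

Definition left_quasi_regular i j h x : Prop :=
  forall y, corner (e j) (gr (- h)) (e i) y ->
    invertible_in (corner (e j) (gr 0) (e j)) (e j) (e j - y ** x).

Definition right_quasi_regular i j h x : Prop :=
  forall y, corner (e j) (gr (- h)) (e i) y ->
    invertible_in (corner (e i) (gr 0) (e i)) (e i) (e i - x ** y).

Lemma corner_unit i : corner (e i) (gr 0) (e i) (e i).
Proof. by apply/cornerP; rewrite (dist_idem eD); split=> //; exact: (dist_deg0 eD). Qed.

Lemma corner_mul i j k g h x y :
    corner (e i) (gr g) (e j) x -> corner (e j) (gr h) (e k) y ->
  corner (e i) (gr (g + h)) (e k) (x ** y).
Proof.
move=> /cornerP[gx xl _] /cornerP[hy _ yr]; apply/cornerP.
by split; [exact: (grading_mul grA) | rewrite numulA xl | rewrite -numulA yr].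
Qed.

Lemma corner_subspace i j h : is_subspace (corner (e i) (gr h) (e j)).
Proof.
have grS := grading_subspace grA h; apply/subspaceP; split.
  by apply/cornerP; rewrite numul0l numul0r; split=> //; exact: subspace0.
move=> a x y /cornerP[gx xl xr] /cornerP[gy yl yr]; apply/cornerP; split.
- by apply: (subspaceD grS) => //; exact: subspaceZ.
- by rewrite numulDr numulZr xl yl.
- by rewrite numulDl numulZl xr yr.
Qed.

Lemma corner_sub_unit i j h x y :
    corner (e i) (gr h) (e j) x -> corner (e j) (gr (- h)) (e i) y ->
  corner (e j) (gr 0) (e j) (e j - y ** x).
Proof.
move=> cx cy; apply: (subspaceB (corner_subspace _ _ _)); first exact: corner_unit.
by have := corner_mul cy cx; rewrite addNr.
Qed.

(** If z inverts e_j - y x, then e_i + x z y inverts e_i - x y. *)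
Lemma invertible_swap i j g h x y :
    corner (e i) (gr g) (e j) x -> corner (e j) (gr h) (e i) y -> g + h = 0 ->
    invertible_in (corner (e j) (gr 0) (e j)) (e j) (e j - y ** x) ->
  invertible_in (corner (e i) (gr 0) (e i)) (e i) (e i - x ** y).
Proof.
move=> cx cy gh0 [_ [z [cz uz zu]]].
have [_ xl xr] := proj1 (cornerP _ _ _ _) cx.
have [_ yl yr] := proj1 (cornerP _ _ _ _) cy.
have [_ zl zr] := proj1 (cornerP _ _ _ _) cz.
have cxy : corner (e i) (gr 0) (e i) (x ** y).
  by have := corner_mul cx cy; rewrite gh0.
have cw : corner (e i) (gr 0) (e i) (x ** z ** y).
  have := corner_mul (corner_mul cx cz) cy.
  by rewrite addr0 gh0.
split; first by apply: (subspaceB (corner_subspace _ _ _)) => //; exact: corner_unit.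
exists (e i + x ** z ** y); split.
- by apply: (subspaceD (corner_subspace _ _ _)) => //; exact: corner_unit.
- have xzy : x ** z ** y - x ** y ** (x ** z ** y) = x ** y.
    rewrite -[in RHS]xr -uz numulBl zl numulBr numulBl.
    by rewrite !numulA.
  rewrite numulDr !numulBl (dist_idem eD).
  rewrite !numulA in xzy *; rewrite xl -(numulA x y (e i)) yr.
  by rewrite xzy subrK.
- have xzy : x ** z ** y - x ** z ** y ** (x ** y) = x ** y.
    rewrite -[in RHS]xr -zu numulBr zr numulBr numulBl.
    by rewrite !numulA.
  rewrite numulDl !numulBr (dist_idem eD) -(numulA _ y (e i)) yr.
  by rewrite xzy numulA xl subrK.
Qed.

Lemma left_right_quasi_regular i j h x : corner (e i) (gr h) (e j) x ->
  left_quasi_regular i j h x <-> right_quasi_regular i j h x.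
Proof.
move=> cx; split=> qx y cy; have := qx y cy.
  by apply: (invertible_swap cx cy); rewrite subrr.
by apply: (invertible_swap cy cx); rewrite addNr.
Qed.

Lemma left_quasi_regular0 i j h : left_quasi_regular i j h 0.
Proof.
move=> y _; rewrite numul0r subr0; split; first exact: corner_unit.
by exists (e j); rewrite (dist_idem eD); split=> //; exact: corner_unit.
Qed.

(** A left inverse of every e_j - y x suffices: the left inverse of e_j - y x
   is again of this form for another y, so it is itself left invertible. *)
Lemma left_quasi_regular_of_inverse i j h x : corner (e i) (gr h) (e j) x ->
    (forall y, corner (e j) (gr (- h)) (e i) y ->
      exists2 z, corner (e j) (gr 0) (e j) z & z ** (e j - y ** x) = e j) ->
  left_quasi_regular i j h x.
Proof.
move=> cx linv y cy; split; first exact: corner_sub_unit cx cy.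
have [z cz zu] := linv y cy; exists z; split=> //.
have [_ zl zr] := proj1 (cornerP _ _ _ _) cz.
have [_ ul ur] := proj1 (cornerP _ _ _ _) (corner_sub_unit cx cy).
have czy : corner (e j) (gr (- h)) (e i) (- (z ** y)).
  apply: (subspaceN (corner_subspace _ _ _)).
  by have := corner_mul cz cy; rewrite add0r.
have [w _ wz] := linv _ czy.
(* z = e_j + z y x again has the shape e_j - y' x, so it has a left inverse w *)
have zE : e j - (- (z ** y)) ** x = z.
  by rewrite numulNl -[in LHS]zu numulBr zr numulA opprK subrK.
rewrite zE in wz; set u := _ - _ in zu ul ur *.
(* associativity of w z u forces w = u *)
have -> : u = w ** e j by rewrite -zu numulA wz ul.
by rewrite -numulA zl.
Qed.

(** * The graded Jacobson radical of a corner *)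

Section Radical.
Variable S : set I.
Local Notation B := (full_corner S).

(** If x is not in M then M + B x = B, and the component of degree 0 and left
   index j of an expression of e_j in M + B x lies in M and is some e_j - y x,
   which divides e_j. *)
Lemma mem_maximal_of_quasi_regular M i j h x : S i -> S j ->
    maximal_graded_left_ideal gr B M ->
    corner (e i) (gr h) (e j) x -> left_quasi_regular i j h x -> M x.
Proof.
move=> Si Sj [/(graded_left_idealP grA)[Ms MB Mc Mm] MnB Mmax] cx qx.
have [hx xl xr] := proj1 (cornerP _ _ _ _) cx.
have Bx : B x by apply: full_corner_peirce xl xr.
have Bs := full_corner_subspace S.
have ee k : e k ** e k = e k := dist_idem eD k.
pose L := [set c | exists m b, [/\ M m, B b & c = m + b ** x]].
have idL : graded_left_ideal gr B L.
  apply/(graded_left_idealP grA); split.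
  - apply/subspaceP; split.
      exists 0, 0; rewrite numul0l addr0.
      by split; [exact: (subspace0 Ms) | exact: (subspace0 Bs) |].
    move=> a _ _ [m [b [Mm' Bb ->]]] [m' [b' [Mm'' Bb' ->]]].
    exists (a *: m + m'), (a *: b + b'); split.
    + by apply: (subspaceD Ms) => //; exact: (subspaceZ Ms).
    + by apply: (subspaceD Bs) => //; exact: (subspaceZ Bs).
    + by rewrite scalerDr numulDl numulZl addrACA.
  - move=> _ [m [b [/MB Bm Bb ->]]]; apply: (subspaceD Bs) => //.
    exact: full_corner_mul.
  - move=> g _ [m [b [Mm' Bb ->]]]; exists (comp g m), (comp (g - h) b).
    split; [exact: Mc | exact: full_corner_comp | ].
    by rewrite compD -(comp_mulr grA hx) subrK.
  - move=> c _ Bc [m [b [Mm' Bb ->]]]; exists (c ** m), (c ** b).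
    split; [exact: Mm | exact: full_corner_mul | ].
    by rewrite numulDr numulA.
have [c Mc'|LM|LB] := Mmax L idL.
- by exists c, 0; rewrite numul0l addr0; split=> //; exact: (subspace0 Bs).
- rewrite -LM; exists 0, (e i).
  split; [exact: (subspace0 Ms) | | by rewrite xl add0r].
  by apply: full_corner_peirce (ee i) (ee i).
- have Bj : B (e j) by apply: full_corner_peirce (ee j) (ee j).
  have : L (e j) by rewrite LB.
  case=> m [b [Mm' Bb ejE]].
  pose y := e j ** comp (- h) b ** e i.
  have cy : corner (e j) (gr (- h)) (e i) y.
    by exists (comp (- h) b) => //; exact: comp_homog.
  have [_ [z [cz _ zu]]] := qx y cy.
  have [_ zl zr] := proj1 (cornerP _ _ _ _) cz.
  have Bz : B z by apply: full_corner_peirce zl zr.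
  have uE : e j - y ** x = e j ** comp 0 m.
    have -> : m = e j - b ** x by rewrite ejE addrK.
    rewrite compB (comp_id grA (dist_deg0 eD j)).
    have -> : comp 0 (b ** x) = comp (- h) b ** x.
      by rewrite -(comp_mulr grA hx) addNr.
    by rewrite numulBr ee numulA /y -(numulA _ (e i)) xl.
  have Mej : M (e j).
    by rewrite -zu uE; apply: (Mm) => //; apply: (Mm) => //; exact: Mc.
  by rewrite -xr; exact: Mm.
Qed.

(** If e_j - y x has no left inverse, a maximal ideal that misses e_j contains
   both e_j - y b_h and y b_h. *)
Lemma quasi_regular_of_mem_jacobson b : gr_jacobson gr B b ->
  forall i j h, left_quasi_regular i j h (e i ** comp h b ** e j).
Proof.
move=> [Bb Jb] i j h.
have [Si|nSi] := pselect (S i); last first.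
  rewrite -comp_el (proj1 (Bb i nSi)) comp0 numul0l; exact: left_quasi_regular0.
have [Sj|nSj] := pselect (S j); last first.
  rewrite -numulA -comp_er (proj2 (Bb j nSj)) comp0 numul0r.
  exact: left_quasi_regular0.
set x := e i ** _ ** _.
have cx : corner (e i) (gr h) (e j) x.
  by exists (comp h b) => //; exact: comp_homog.
apply: (left_quasi_regular_of_inverse cx) => y cy.
have [_ yl yr] := proj1 (cornerP _ _ _ _) cy.
have [hu ul ur] := proj1 (cornerP _ _ _ _) (corner_sub_unit cx cy).
set u := _ - _ in hu ul ur *.
have ee : e j ** e j = e j := dist_idem eD j.
have Bj : B (e j) by exact: (full_corner_peirce Sj Sj ee ee).
pose L := [set c | B c /\ exists a, c ** e j = a ** u].
have [[Bej [a eja]]|nLej] := pselect (L (e j)).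
  exists (e j ** comp 0 a ** e j).
    by exists (comp 0 a) => //; exact: comp_homog.
  rewrite -!numulA ul -(comp_mulr grA hu) addr0 -eja ee.
  by rewrite (comp_id grA (dist_deg0 eD j)) ee.
have idL : graded_left_ideal gr B L.
  apply/(graded_left_idealP grA); split.
  - apply/subspaceP; split.
      by split; [exact: subspace0 (full_corner_subspace S) | exists 0; rewrite !numul0l].
    move=> k c d [Bc [a ca]] [Bd [a' da']]; split.
      by case/subspaceP: (full_corner_subspace S) => _; apply.
    by exists (k *: a + a'); rewrite !numulDl !numulZl ca da'.
  - by move=> c [].
  - move=> g c [Bc [a ca]]; split; first exact: full_corner_comp.
    by exists (comp g a); rewrite -comp_er ca -(comp_mulr grA hu) addr0.
  - move=> d c Bd [Bc [a ca]]; split; first exact: full_corner_mul.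
    by exists (d ** a); rewrite -!numulA ca.
have Lej c : B c -> L (c - c ** e j).
  move=> Bc; split.
    apply: (subspaceB (full_corner_subspace S) Bc); exact: full_corner_mul.
  by exists 0; rewrite numul0l numulBl -numulA ee subrr.
have [M [maxM LM nMej]] :=
  exists_maximal_graded_left_ideal grA idL Bj nLej Lej.
have [/(graded_left_idealP grA)[Ms MB Mc Mm] _ _] := maxM.
have By : B y by apply: full_corner_peirce yl yr.
have My : M (y ** comp h b) by apply: (Mm) => //; apply: Mc; exact: Jb.
case: nMej; rewrite -(subrK (y ** comp h b) (e j)); apply: subspaceD => //.
apply: LM; split; first exact: (subspaceB (full_corner_subspace S) Bj (MB _ My)).
exists (e j); rewrite ul /u /x numulBl ee !numulA yr.
by [].
Qed.

(** The criterion on the right mentions S only through membership in the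
   corner: this is why the radicals of the e_F A e_F are restrictions of one
   and the same subset of A. *)
Theorem gr_jacobson_peirce b : gr_jacobson gr B b <->
  B b /\ forall i j h, left_quasi_regular i j h (e i ** comp h b ** e j).
Proof.
split=> [Jb|[Bb qb]].
  by split; [case: Jb | exact: quasi_regular_of_mem_jacobson].
split=> // M maxM.
have [/(graded_left_idealP grA)[Ms _ _ _] _ _] := maxM.
apply: (subspace_homog_peirce Ms) => i j h.
have [Si|nSi] := pselect (S i); last first.
  rewrite -comp_el (proj1 (Bb i nSi)) comp0 numul0l; exact: subspace0.
have [Sj|nSj] := pselect (S j); last first.
  rewrite -numulA -comp_er (proj2 (Bb j nSj)) comp0 numul0r; exact: subspace0.
apply: (mem_maximal_of_quasi_regular Si Sj maxM _ (qb i j h)).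
by exists (comp h b) => //; exact: comp_homog.
Qed.

End Radical.

(** * Comparison with the graded subspace J *)

Definition quasi_regular_set : set A :=
  [set a | forall i j h, left_quasi_regular i j h (e i ** comp h a ** e j)].

Lemma quasi_regular_set_corner i j h x : corner (e i) (gr h) (e j) x ->
  quasi_regular_set x <-> left_quasi_regular i j h x.
Proof.
move=> /cornerP[hx xl xr]; split=> [/(_ i j h)|qx i' j' h'].
  by rewrite (comp_id grA hx) xl xr.
rewrite (comp_of_homog grA hx); case: eqP => [->|_]; last first.
  rewrite numul0r numul0l; exact: left_quasi_regular0.
have [->|ii'] := pselect (i' = i); last first.
  rewrite -xl numulA (dist_orth eD ii') !numul0l; exact: left_quasi_regular0.
have [->|jj'] := pselect (j' = j); first by rewrite xl xr.
have -> : e i ** x ** e j' = 0.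
  by rewrite xl -xr -numulA (dist_orth eD) ?numul0r // => E; apply: jj'.
exact: left_quasi_regular0.
Qed.

Lemma bigcap_maximalE :
  \bigcap_(M in maximal_graded_left_ideal gr setT) M = quasi_regular_set.
Proof.
rewrite -[LHS]setTI; apply/seteqP; rewrite -full_cornerT.
split=> a; first by case/gr_jacobson_peirce.
by move=> qa; apply/gr_jacobson_peirce; split=> // i [].
Qed.

Lemma bigcup_jacobsonE :
  \bigcup_(F : {fset I})
    gr_jacobson gr (corner (idem_sum e F) setT (idem_sum e F)) =
  quasi_regular_set.
Proof.
apply/seteqP; split=> [a [F _]|a qa].
  by rewrite -full_corner_fset => /gr_jacobson_peirce[].
have [F aF] := local_unitl a; have [G aG] := local_unitr a.
exists (F `|` G)%fset => //; rewrite -full_corner_fset; apply/gr_jacobson_peirce.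
split=> // i /negP; rewrite in_fsetU negb_or => /andP[iF iG].
split; first by rewrite -aF numulA idem_sum_notin // numul0l.
by rewrite -aG -numulA notin_idem_sum // numul0r.
Qed.

Lemma eq_quasi_regular_setP (J : set A) : graded_subspace gr J ->
    (forall i j a, J a -> J (e i ** a ** e j)) ->
  J = quasi_regular_set <->
  forall i j h x, corner (e i) (gr h) (e j) x ->
    (J x <-> left_quasi_regular i j h x).
Proof.
move=> /(graded_subspaceP grA)[Js Jc] Je; split=> [->|JE] .
  by move=> i j h x; exact: quasi_regular_set_corner.
have cE i j h a : corner (e i) (gr h) (e j) (e i ** comp h a ** e j).
  by exists (comp h a) => //; exact: comp_homog.
apply/seteqP; split=> a.
  by move=> Ja i j h; apply/(JE i j h) => //; apply/Je/Jc.
by move=> qa; apply: (subspace_homog_peirce Js) => i j h; apply/(JE i j h).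
Qed.

End Peirce.

(** * Passage to the opposite algebra *)

Section OppositeTransfer.
Variables (K : fieldType) (H : zmodType) (A : nuAlgType K).
Variables (gr : H -> set A) (I : choiceType) (e : I -> A).

Let grO : H -> set (opposite A) := gr.
Let eO : I -> opposite A := e.

Lemma opposite_grading : is_grading gr -> is_grading grO.
Proof.
case=> grS grT grM; split=> // g h x y gx hy.
by rewrite addrC; exact: (grM h g y x).
Qed.

Lemma opposite_distinguished :
  distinguished_family gr e -> distinguished_family grO eO.
Proof.
case=> neq0 idem orth deg0 suml sumr; split=> // i j ij.
by apply: orth => ji; apply: ij.
Qed.

Lemma opposite_corner (f g : A) (S : set A) :
  corner (f : opposite A) (S : set (opposite A)) (g : opposite A) = corner g S f.
Proof.
apply/seteqP; split=> _ [s Ss <-]; exists s => //.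
  exact: esym (@numulA K A g s f).
exact: (@numulA K A g s f).
Qed.

Lemma opposite_invertible (S : set A) (f u : A) :
  invertible_in (S : set (opposite A)) (f : opposite A) u <-> invertible_in S f u.
Proof. by split=> -[Su [z [Sz uz zu]]]; split=> //; exists z. Qed.

End OppositeTransfer.

Theorem proposition2p6 (K : fieldType) (H : zmodType) (A : nuAlgType K)
    (gr : H -> set A) (grA : is_grading gr)
    (I : choiceType) (e : I -> A)
    (e_dist : distinguished_family gr e)
    (e_prim : forall i, primitive_idempotent (e i))
    (J : set A) (grJ : graded_subspace gr J)
    (J_sum : is_direct_sum (fun p : I * I => corner (e p.1) J (e p.2)) J) :
  [<-> J = \bigcap_(M in maximal_graded_left_ideal gr setT) M;

       J = \bigcap_(M in maximal_graded_right_ideal gr setT) M;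

       forall (i j : I) (h : H) (x : A), corner (e i) (gr h) (e j) x ->
         (J x <->
          forall y : A, corner (e j) (gr (- h)) (e i) y ->
            invertible_in (corner (e j) (gr 0) (e j)) (e j) (e j - y ** x));

       forall (i j : I) (h : H) (x : A), corner (e i) (gr h) (e j) x ->
         (J x <->
          forall y : A, corner (e j) (gr (- h)) (e i) y ->
            invertible_in (corner (e i) (gr 0) (e i)) (e i) (e i - x ** y));

       J = \bigcup_(F : {fset I})
             gr_jacobson gr (corner (idem_sum e F) setT (idem_sum e F))].
Proof.
have Je i j a : J a -> J (e i ** a ** e j).
  move=> Ja; have [-> _] := J_sum.
  exists [fset (i, j)]%fset, (fun=> e i ** a ** e j).
  split; last by rewrite big_seq_fset1.
  by move=> t; rewrite in_fset1 => /eqP->; exists a.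
pose P3 := forall i j h x, corner (e i) (gr h) (e j) x ->
  (J x <-> left_quasi_regular gr e i j h x).
pose P4 := forall i j h x, corner (e i) (gr h) (e j) x ->
  (J x <-> right_quasi_regular gr e i j h x).
have E1 : J = \bigcap_(M in maximal_graded_left_ideal gr setT) M <-> P3.
  rewrite (bigcap_maximalE grA e_dist).
  exact: eq_quasi_regular_setP.
have E5 : J = \bigcup_(F : {fset I})
    gr_jacobson gr (corner (idem_sum e F) setT (idem_sum e F)) <-> P3.
  rewrite (bigcup_jacobsonE grA e_dist).
  exact: eq_quasi_regular_setP.
have E34 : P3 <-> P4.
  split=> PJ i j h x cx; apply: (iff_trans (PJ _ _ _ _ cx)).
    exact: left_right_quasi_regular.
  exact: (iff_sym (left_right_quasi_regular grA e_dist cx)).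
have E2 : J = \bigcap_(M in maximal_graded_right_ideal gr setT) M <-> P4.
  (* right ideals of A are, by unfolding, left ideals of the opposite algebra,
     where i and j exchange their roles *)
  have grAO := opposite_grading grA.
  have eDO := opposite_distinguished e_dist.
  have -> : \bigcap_(M in maximal_graded_right_ideal gr setT) M =
      quasi_regular_set grAO (e : I -> opposite A).
    by rewrite -(bigcap_maximalE grAO eDO).
  rewrite (@eq_quasi_regular_setP K H (opposite A) gr grAO I e eDO J grJ); last first.
    by move=> i j a /(Je j i); rewrite -numulA.
  split=> PJ i j h x; have := PJ j i h x; rewrite opposite_corner => PJx.
    move=> /PJx->; split=> qx y; have := qx y; rewrite opposite_corner => qxy /qxy.
      by rewrite opposite_corner => /opposite_invertible.
    by move=> inv; rewrite opposite_corner; exact/opposite_invertible.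
  move=> /PJx->; split=> qx y; have := qx y; rewrite opposite_corner => qxy /qxy.
    by move=> inv; rewrite opposite_corner; exact/opposite_invertible.
  by rewrite opposite_corner => /opposite_invertible.
tfae.
- by move=> /E1 /E34 /E2.
- by move=> /E2 /E34.
- by move=> /E34.
- by move=> /E34 /E5.
- by move=> /E5 /E1.
Qed.
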